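(* Let $k\ge3$. Then $V_L^+=M(1)^++V_L^+(1)+C_2(V_L^+)$; that is, $V_L^+/C_2(V_L^+)$ is spanned by the images of $M(1)^+$ and $V_L^+(1)$.
   Context: $L=\mathbb{Z}\alpha$, $\langle\alpha,\alpha\rangle=2k$; $V_L=M(1)\otimes\mathbb{C}[L]$ the lattice VOA, $V_L^+$ the fixed points of the involution $\theta$ lifted from $-1$ on $L$, $M(1)^{\pm}$ the $\pm1$-eigenspaces of $\theta$ on $M(1)$, and $V_L^+(1)=M(1)^+\otimes(e^{\alpha}+e^{-\alpha})\oplus M(1)^-\otimes(e^{\alpha}-e^{-\alpha})$. $C_2(V)$ is the span of $\{v_{-2}u:u,v\in V\}$. *)

(* Defs.v *)
(* Concrete construction of the rank-one lattice VOA
   V_L, L = Z alpha, <alpha,alpha> = 2k, over the complex numbers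
   C = (Stdlib reals)[i], following the standard (FLM / Lepowsky-Li)
   construction. *)
From mathcomp Require Import all_boot all_algebra.
From mathcomp Require Import complex.
From mathcomp Require Import Rstruct.
Set Implicit Arguments.
Unset Strict Implicit.
Unset Printing Implicit Defensive.
Import GRing.Theory.
Local Open Scope ring_scope.

Definition C : fieldType := (Rdefinitions.R)[i].

(* Basis vectors of V_L = M(1) (x) C[L]:
   a key (p, m) with p = [:: i_1; ...; i_r] and m : int stands for
     alpha(-(i_1+1)) ... alpha(-(i_r+1)) 1  (x)  e^{m alpha}.
   Heisenberg negative modes commute, so p is read up to permutation. *)
Definition key := (seq nat * int)%type.

(* A vector of V_L is a finite formal linear combination of keys. *)
Definition vec := seq (C * key).

Definition coef (v : vec) (b : key) : C :=
  \sum_(t <- v | perm_eq t.2.1 b.1 && (t.2.2 == b.2)) t.1.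

Definition vequiv (v w : vec) : Prop := forall b, coef v b = coef w b.

Definition vscale (c : C) (v : vec) : vec := [seq (c * t.1, t.2) | t <- v].

Definition lin (f : key -> vec) (v : vec) : vec :=
  flatten [seq vscale t.1 (f t.2) | t <- v].

Definition bvec (b : key) : vec := [:: (1, b)].

Section LatticeVOA.
Variable k : nat. (* <alpha, alpha> = 2k *)

(* Fock degree of a monomial, and L_0-weight of a basis vector:
   wt(alpha(-n_1)...alpha(-n_r) e^{m alpha}) = n_1+...+n_r + k m^2. *)
Definition fdeg (p : seq nat) : nat := \sum_(i <- p) i.+1.
Definition wt (b : key) : nat := (fdeg b.1 + k * (absz b.2) ^ 2)%N.

(* The Heisenberg operator alpha(n) on basis vectors:
   alpha(-n) (n > 0) creates, alpha(0) = 2km on e^{m alpha},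
   alpha(n) (n > 0) acts as 2k n d/d alpha(-n). *)
Definition amode (n : int) (b : key) : vec :=
  match n with
  | Posz 0 => [:: ((2 * k)%:R * b.2%:~R, b)]
  | Posz n'.+1 => [:: ((2 * k * n'.+1 * count_mem n' b.1)%:R, (rem n' b.1, b.2))]
  | Negz n' => [:: (1, (n' :: b.1, b.2))]
  end.

(* Coefficient of z^b in E^-(-beta, z) = exp(sum_{n>0} beta(-n) z^n / n),
   beta = j alpha, computed by  b S_b = sum_{n=1}^b beta(-n) S_{b-n}. *)
Fixpoint Sop (j : int) (fuel b : nat) (v : vec) : vec :=
  match fuel with
  | 0 => if b == 0%N then v else [::]
  | fuel'.+1 =>
    if b == 0%N then v else
    vscale (j%:~R / b%:R)
      (flatten [seq lin (amode (Negz n)) (Sop j fuel' (b - n.+1) v)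
               | n <- iota 0 b])
  end.

(* Coefficient of z^{-a} in E^+(-beta, z) = exp(- sum_{n>0} beta(n) z^{-n} / n),
   computed by  a T_a = - sum_{n=1}^a beta(n) T_{a-n}. *)
Fixpoint Top (j : int) (fuel a : nat) (v : vec) : vec :=
  match fuel with
  | 0 => if a == 0%N then v else [::]
  | fuel'.+1 =>
    if a == 0%N then v else
    vscale (- (j%:~R / a%:R))
      (flatten [seq lin (amode (Posz n.+1)) (Top j fuel' (a - n.+1) v)
               | n <- iota 0 a])
  end.

(* Modes of Y(e^{j alpha}, z) = E^-(-beta,z) E^+(-beta,z) e_beta z^beta
   (trivial cocycle, legitimate since L is even of rank one):
   (e^{j alpha})_n (u (x) e^{m alpha})
     = sum_{a - b = n + 1 + 2kjm} S_b T_a (u (x) e^{(m+j) alpha}). *)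
Definition evmode (j n : int) (w : key) : vec :=
  let v0 := bvec (w.1, w.2 + j) in
  flatten [seq (let bb : int := (a%:Z - n - 1 - (2 * k)%:Z * j * w.2)%R in
                if (0 <= bb)%R then Sop j (absz bb) (absz bb) (Top j a a v0)
                else [::])
          | a <- iota 0 (fdeg w.1).+1].

(* Modes v_s of a basis vector v = (p, j), by induction on p, using the
   iterate formula for v = alpha(-q) b' (a = alpha(-1)1, a_n = alpha(n)):
   (a_{-q} b')_s = sum_{i>=0} binom(q+i-1, i)
                      (a_{-q-i} b'_{s+i} - (-1)^q b'_{s-q-i} a_i).
   The sums are finite on each vector: b'_t w = 0 for t >= wt b' + wt w,
   and a_i w = 0 for i > fdeg w. *)
Fixpoint mode (p : seq nat) (j : int) (s : int) (w : key) {struct p} : vec :=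
  match p with
  | [::] => evmode j s w
  | i :: p' =>
    let q := i.+1 in
    let B := (wt (p', j) + wt w + absz s)%N in
    flatten [seq vscale ('C(q + i' - 1, i'))%:R
                   (lin (amode (- (q + i')%:Z)) (mode p' j (s + i'%:Z) w))
            | i' <- iota 0 B]
    ++
    flatten [seq vscale (- ((-1) ^+ q * ('C(q + i' - 1, i'))%:R))
                   (lin (mode p' j (s - q%:Z - i'%:Z)) (amode i'%:Z w))
            | i' <- iota 0 (fdeg w.1).+1]
  end.

(* The product u_s w (coefficient of z^{-s-1} in Y(u, z) w). *)
Definition vmode (u : vec) (s : int) (w : vec) : vec :=
  flatten [seq vscale t.1 (lin (mode t.2.1 t.2.2 s) w) | t <- u].

End LatticeVOA.

(* The involution theta lifted from -1 on L:
   theta(alpha(-n_1)...alpha(-n_r) e^{m alpha})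
      = (-1)^r alpha(-n_1)...alpha(-n_r) e^{-m alpha}. *)
Definition theta (b : key) : vec := [:: ((-1) ^+ size b.1, (b.1, - b.2))].

Definition in_VLplus (v : vec) : Prop := vequiv (lin theta v) v.

Definition in_M1 (v : vec) : Prop := forall b, b.2 != 0 -> coef v b = 0.
Definition in_M1plus (v : vec) : Prop := in_M1 v /\ vequiv (lin theta v) v.
Definition in_M1minus (v : vec) : Prop :=
  in_M1 v /\ vequiv (lin theta v) (vscale (-1) v).

(* u (x) e^{m alpha} for u in M(1). *)
Definition tensor_e (u : vec) (m : int) : vec :=
  [seq (t.1, (t.2.1, t.2.2 + m)) | t <- u].

Definition in_VLplus1 (v : vec) : Prop :=
  exists u1 u2, in_M1plus u1 /\ in_M1minus u2 /\
    vequiv v (tensor_e u1 1 ++ tensor_e u1 (-1)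
              ++ tensor_e u2 1 ++ vscale (-1) (tensor_e u2 (-1))).

Definition in_C2_VLplus (k : nat) (x : vec) : Prop :=
  exists l : seq (C * vec * vec),
    (forall t, t \in l -> in_VLplus t.1.2 /\ in_VLplus t.2) /\
    vequiv x (flatten [seq vscale t.1.1 (vmode k t.1.2 (-2) t.2) | t <- l]).

(* Main.v *)
(* Write V(m) = M(1) (x) e^(m alpha) and let (e^alpha)_n be the modes of e^alpha.
   For m >= 2, V(m) is spanned by the (e^alpha)_n w with n <= -2 and w in V(m-1):
   this span is stable under the alpha(-i), i > 0, because
   [alpha(-i), (e^alpha)_n] = 2k (e^alpha)_(n-i), and it contains
   e^(m alpha) = (e^alpha)_n e^((m-1) alpha) for n = -2k(m-1)-1 <= -2.
   Put E = e^alpha + e^(-alpha).  For v = (e^alpha)_n w and g = (e^(-alpha))_n w,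
   which lies in V(m-2), one has
     v + theta v = E_n (w + theta w) - (g + theta g).
   Since (L(-1)u)_s = -s u_(s-1), E_n is a nonzero multiple of
   (L(-1)^(-2-n) E)_(-2), so the first term is in C_2, and induction on m
   applies to the second. *)
Require Import Defs.
From HB Require Import structures.
From mathcomp Require Import all_boot all_order all_algebra complex Rstruct.
From mathcomp Require Import boolp functions zify ring.
Set Implicit Arguments.
Unset Strict Implicit.
Unset Printing Implicit Defensive.
Import Order.TTheory GRing.Theory Num.Theory.
Local Open Scope ring_scope.

(* Vectors are studied through [coef]: [vequiv] is then an equality in the
   C-module [fV]. *)
Definition fV : lmodType C := (key -> C^o).

(** [C] is declared as a bare field, so characteristic zero has to come from the numeric structure
    of [Rdefinitions.R[i]]. *)
Lemma C_natr_neq0 n : (n.+1%:R : C) != 0.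
Proof. by rewrite (pnatr_eq0 (Rdefinitions.R[i])). Qed.

Lemma fV_ext (f g : fV) : (forall b, f b = g b) -> f = g.
Proof. by move=> e; apply: funext. Qed.

Lemma fVDE (f g : fV) b : (f + g) b = f b + g b.
Proof. by []. Qed.

Lemma fVZE c (f : fV) b : (c *: f) b = c * f b.
Proof. by []. Qed.

Lemma fV_sumE (I : Type) (s : seq I) (F : I -> fV) b :
  (\sum_(i <- s) F i) b = \sum_(i <- s) F i b.
Proof. by elim: s => [|i s IH]; rewrite ?big_nil // !big_cons fVDE IH. Qed.

Lemma vequivE v w : vequiv v w <-> (coef v : fV) = coef w.
Proof. by split=> [e|e b]; [apply: fV_ext | exact: (congr1 (@^~ b) e)]. Qed.

Lemma coef_nil : coef [::] = 0 :> fV.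
Proof. by apply: fV_ext => b; rewrite /coef big_nil. Qed.

Lemma coef_cat v w : coef (v ++ w) = coef v + coef w :> fV.
Proof. by apply: fV_ext => b; rewrite /coef big_cat. Qed.

Lemma coef_scale c v : coef (vscale c v) = c *: (coef v : fV).
Proof.
by apply: fV_ext => b; rewrite fVZE /coef big_map mulr_sumr.
Qed.

Lemma coef_flatten (I : Type) (s : seq I) (F : I -> vec) :
  coef (flatten [seq F i | i <- s]) = \sum_(i <- s) (coef (F i) : fV).
Proof.
by elim: s => [|i s IH] /=; rewrite ?big_nil ?coef_nil // big_cons coef_cat IH.
Qed.

Lemma coef_lin f v :
  coef (lin f v) = \sum_(t <- v) t.1 *: (coef (f t.2) : fV).
Proof. by rewrite coef_flatten; apply: eq_bigr => t _; rewrite coef_scale. Qed.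

Definition delta (b : key) : fV := coef (bvec b).

Lemma deltaE b b' :
  delta b b' = (perm_eq b.1 b'.1 && (b.2 == b'.2))%:R.
Proof. by rewrite /delta /coef big_mkcond big_seq1 /=; case: ifP. Qed.

Lemma coef_delta v : coef v = \sum_(t <- v) t.1 *: delta t.2.
Proof.
apply: fV_ext => b; rewrite fV_sumE /coef big_mkcond; apply: eq_bigr => t _.
by rewrite fVZE deltaE /=; case: ifP => _; rewrite ?mulr1 ?mulr0.
Qed.

(** [fV] contains functions that distinguish orderings of one monomial. The Heisenberg relations are
    proved on the functions that do not. *)
Definition perm_inv (f : fV) :=
  forall p q m, perm_eq p q -> f (p, m) = f (q, m).

Lemma perm_inv_delta b : perm_inv (delta b).
Proof.
move=> p q m e; rewrite !deltaE /=; congr (_%:R).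
by congr (nat_of_bool (_ && _)); apply/idP/idP => h; apply: (perm_trans h); rewrite // perm_sym.
Qed.

Lemma perm_inv_scale c f : perm_inv f -> perm_inv (c *: f).
Proof. by move=> h p q m e; rewrite !fVZE (h p q). Qed.

Lemma perm_inv_sum (I : Type) (s : seq I) (F : I -> fV) :
  (forall i, perm_inv (F i)) -> perm_inv (\sum_(i <- s) F i).
Proof.
by move=> h p q m e; rewrite !fV_sumE; apply: eq_bigr => i _; apply: h.
Qed.

(* [homog d m f]: f is supported on the monomials of Fock degree d and charge
   m; since d is an integer, [homog d m f] with d < 0 forces f = 0. *)
Definition homog (d m : int) (f : fV) :=
  forall b, f b != 0 -> (fdeg b.1)%:Z = d /\ b.2 = m.

Lemma homog0 d m : homog d m 0.
Proof. by move=> b; rewrite eqxx. Qed.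

Lemma homogD d m f g : homog d m f -> homog d m g -> homog d m (f + g).
Proof.
move=> hf hg b; rewrite fVDE; case: (eqVneq (f b) 0) => [->|/hf //].
by rewrite add0r => /hg.
Qed.

Lemma homogZ d m c f : homog d m f -> homog d m (c *: f).
Proof. by move=> hf b; rewrite fVZE mulf_eq0 negb_or => /andP[_ /hf]. Qed.

Lemma homog_sum d m (I : eqType) (s : seq I) (F : I -> fV) :
  (forall i, i \in s -> homog d m (F i)) -> homog d m (\sum_(i <- s) F i).
Proof.
move=> h; rewrite big_seq; apply: big_ind => //.
  exact: homog0.
exact: homogD.
Qed.

Lemma homog_neg d m f : homog d m f -> d < 0 -> f = 0.
Proof.
move=> h d0; apply: fV_ext => b; apply/eqP/negPn/negP => /h[e _]; lia.
Qed.

Lemma fdeg_cons i p : fdeg (i :: p) = (i.+1 + fdeg p)%N.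
Proof. by rewrite /fdeg big_cons. Qed.

Lemma fdeg_perm p q : perm_eq p q -> fdeg p = fdeg q.
Proof. exact: perm_big. Qed.

Lemma fdeg_rem i p : i \in p -> fdeg p = (i.+1 + fdeg (rem i p))%N.
Proof. by move=> h; rewrite (fdeg_perm (perm_to_rem h)) fdeg_cons. Qed.

Lemma homog_delta b : homog (fdeg b.1)%:Z b.2 (delta b).
Proof.
move=> b'; rewrite deltaE; case: (boolP (perm_eq _ _)) => [|_]; last by rewrite eqxx.
by move=> /fdeg_perm ->; case: (b.2 =P b'.2) => [->|_]; rewrite ?eqxx.
Qed.

(** * Heisenberg operators and vertex operators of e^(j alpha) *)

Section Operators.
Variable k : nat.

(** The transpose of [amode]: the value at b is read off from the monomial that alpha(n) sends to b.
    For n = n'+1 this is n' :: b.1, which contains n' once more than b.1 does. *)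
Definition Aop (n : int) (f : fV) : fV := fun b =>
  match n with
  | Posz 0 => ((2 * k)%:R * b.2%:~R) * f b
  | Posz n'.+1 =>
      (2 * k * n'.+1 * (count_mem n' b.1).+1)%:R * f (n' :: b.1, b.2)
  | Negz n' => if n' \in b.1 then f (rem n' b.1, b.2) else 0
  end.

Lemma Aop_is_linear n : linear (Aop n).
Proof.
move=> c f g; apply: fV_ext => b; rewrite !fVDE !fVZE /=.
case: n => [[|n]|n] /=; last by case: ifP => _; rewrite ?mulr0 ?addr0.
  by rewrite mulrDr mulrCA.
by rewrite mulrDr mulrCA.
Qed.
HB.instance Definition _ n :=
  GRing.isLinear.Build C fV fV _ (Aop n) (Aop_is_linear n).

Lemma coef_amode n b : coef (amode k n b) = Aop n (delta b).
Proof.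
apply: fV_ext => -[q m]; case: b => p m'.
rewrite coef_delta /=; case: n => [[|n]|n] /=; rewrite big_seq1 fVZE !deltaE /=.
- by case: (m' =P m) => [->//|_]; rewrite andbF !mulr0.
- case: (boolP (n \in p)) => np; last first.
    have /count_memPn -> := np; rewrite muln0 mul0r.
    suff -> : perm_eq p (n :: q) = false by rewrite mulr0.
    by apply: contraNF np => /perm_mem ->; rewrite inE eqxx.
  have -> : perm_eq (rem n p) q = perm_eq p (n :: q).
    by rewrite (permPl (perm_to_rem np)) perm_cons.
  case: (boolP (perm_eq p (n :: q))) => [/permP/(_ (pred1 n)) -> /=|_].
    by rewrite eqxx add1n.
  by rewrite !mulr0.
- rewrite mul1r; case: ifP => [nq|/negbT nq].
    by rewrite (permPr (perm_to_rem nq)) perm_cons.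
  suff -> : perm_eq (n :: p) q = false by [].
  by apply: contraNF nq => /perm_mem <-; rewrite inE eqxx.
Qed.

Lemma coef_lin_amode n v : coef (lin (amode k n) v) = Aop n (coef v).
Proof.
rewrite coef_lin [in RHS]coef_delta linear_sum; apply: eq_bigr => t _.
by rewrite coef_amode linearZ.
Qed.

Lemma perm_inv_A n f : perm_inv f -> perm_inv (Aop n f).
Proof.
move=> h p q m e; case: n => [[|n]|n] /=; first by rewrite (h p q).
  by have /permP -> := e; rewrite (h (n :: p) (n :: q)) // perm_cons.
rewrite /= (perm_mem e); case: ifP => // nq; apply: h.
have np : n \in p by rewrite (perm_mem e).
by rewrite -(perm_cons n) -(permPl (perm_to_rem np)) -(permPr (perm_to_rem nq)).
Qed.

Lemma homog_A n d m f : homog d m f -> homog (d - n) m (Aop n f).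
Proof.
move=> h [p m'] /=; case: n => [[|n]|n] /=.
- by rewrite subr0 mulf_eq0 negb_or => /andP[_ /h].
- rewrite mulf_eq0 negb_or => /andP[_ /h] /=; rewrite fdeg_cons => -[<- ->].
  by split=> //; lia.
case: ifP => [np /h /=|]; last by rewrite eqxx.
by rewrite (fdeg_rem np) => -[<- ->]; split=> //; lia.
Qed.

(** * Heisenberg commutation relations *)

Lemma Aop_pos_comm m n f : perm_inv f ->
  Aop (Posz m.+1) (Aop (Posz n.+1) f) = Aop (Posz n.+1) (Aop (Posz m.+1) f).
Proof.
move=> h; apply: fV_ext => -[p j] /=.
rewrite (h [:: n, m & p] [:: m, n & p]); last by apply/permP => a /=; rewrite addnCA.
rewrite !mulrA -!natrM; congr (_%:R * _).
by rewrite (eq_sym m n); case: (n =P m) => [->|_]; rewrite ?add0n //; ring.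
Qed.

Lemma Aop_neg_comm m n f : perm_inv f ->
  Aop (Negz m) (Aop (Negz n) f) = Aop (Negz n) (Aop (Negz m) f).
Proof.
move=> h; apply: fV_ext => -[p j] /=.
case: (eqVneq n m) => [->//|nm].
case: (boolP (m \in p)) => mp; case: (boolP (n \in p)) => np //.
- have -> : n \in rem m p by move: np; rewrite (perm_mem (perm_to_rem mp)) inE (negbTE nm).
  have -> : m \in rem n p by move: mp; rewrite (perm_mem (perm_to_rem np)) inE eq_sym (negbTE nm).
  apply: h; rewrite -(perm_cons n) -(perm_cons m).
  have e1 : perm_eq p [:: m, n & rem n (rem m p)].
    rewrite (permPl (perm_to_rem mp)) perm_cons; apply: perm_to_rem.
    by move: np; rewrite (perm_mem (perm_to_rem mp)) inE (negbTE nm).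
  have e2 : perm_eq p [:: n, m & rem m (rem n p)].
    rewrite (permPl (perm_to_rem np)) perm_cons; apply: perm_to_rem.
    by move: mp; rewrite (perm_mem (perm_to_rem np)) inE eq_sym (negbTE nm).
  rewrite -(permPl e1) (permPl e2).
  by apply/permP => a /=; rewrite addnCA.
- by rewrite (contraNF (@mem_rem _ _ _ _) np).
by rewrite (contraNF (@mem_rem _ _ _ _) mp).
Qed.

(** If p contains m exactly c times and m = n, the two orders carry the multiplicities c + 1 and c;
    the difference is the central term. *)
Lemma Aop_pos_neg m n f : perm_inv f ->
  Aop (Posz m.+1) (Aop (Negz n) f) =
  Aop (Negz n) (Aop (Posz m.+1) f) + (m == n)%:R *: ((2 * k * m.+1)%:R *: f).
Proof.
move=> h; apply: fV_ext => -[p j]; rewrite fVDE !fVZE /= inE.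
rewrite (eq_sym m n).
case: (n =P m) => [->|nm] /=.
  rewrite mul1r; case: (boolP (m \in p)) => mp.
    rewrite (h (m :: rem m p) p) 1?perm_sym; last exact: perm_to_rem.
    rewrite -mulrDl -natrD; congr (_%:R * _).
    rewrite count_rem mp /= eqxx.
    have : (0 < count_mem m p)%N by rewrite -has_count has_pred1.
    by move: (count_mem m p) => c; case: c => // c _; rewrite subn1 /=; ring.
  by rewrite (count_memPn mp) add0r muln1.
rewrite mul0r addr0.
case: ifP => np; last by rewrite mulr0.
by rewrite count_rem np /= (introF eqP nm) subn0.
Qed.

Lemma scale_swap (a b : C) (f : fV) : a *: (b *: f) = b *: (a *: f).
Proof. by rewrite !scalerA mulrC. Qed.

Lemma sum_iota n (F : nat -> fV) :
  \sum_(i <- iota 0 n) F i = \sum_(i < n) F i.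
Proof. by rewrite -[in iota 0 n](subn0 n) -/(index_iota 0 n) big_mkord. Qed.

(** * Exponentials of Heisenberg operators *)

Section Exponential.
Variables (c : C) (md : nat -> int).

(* [expo_rec b b], and [expo b] below, is the coefficient of z^b in
   exp(c * sum_n Aop (md n) z^(n+1) / (n+1)); [expo] is 0 at negative indices. *)
Fixpoint expo_rec (fuel b : nat) (f : fV) : fV :=
  if b == 0%N then f else
  if fuel is fuel'.+1 then
    (c / b%:R) *: \sum_(n <- iota 0 b) Aop (md n) (expo_rec fuel' (b - n.+1) f)
  else 0.

Lemma expo_recS fuel b f : expo_rec fuel.+1 b.+1 f =
  (c / b.+1%:R) *: \sum_(n < b.+1) Aop (md n) (expo_rec fuel (b - n) f).
Proof.
by rewrite -[RHS]/(_ *: _) -(sum_iota b.+1 (fun n => Aop (md n) (expo_rec fuel (b - n) f))).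
Qed.

Lemma expo_rec_fuel fuel b f :
  (b <= fuel)%N -> expo_rec fuel b f = expo_rec b b f.
Proof.
elim/ltn_ind: fuel b f => -[|fuel] IH [|b] f hb //.
rewrite !expo_recS; congr (_ *: _); apply: eq_bigr => n _.
by congr (Aop _ _); rewrite IH ?[in RHS]IH //; lia.
Qed.

Lemma expo_rec_is_linear fuel b : linear (expo_rec fuel b).
Proof.
elim: fuel b => [|fuel IH] [|b] a f g //; first by rewrite /= scaler0 addr0.
rewrite !expo_recS; move: (c / _) => d.
rewrite scalerA [a * d]mulrC -[(d * a) *: _]scalerA -scalerDr; congr (_ *: _).
rewrite scaler_sumr -big_split /=; apply: eq_bigr => n _.
by rewrite IH linearP.
Qed.

Definition expo (z : int) (f : fV) : fV :=
  if z is Posz b then expo_rec b b f else 0.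

Arguments expo : simpl never.

Lemma expo_is_linear z : linear (expo z).
Proof.
case: z => b a f g; first exact: expo_rec_is_linear.
by rewrite /expo scaler0 addr0.
Qed.
HB.instance Definition _ z :=
  GRing.isLinear.Build C fV fV _ (expo z) (expo_is_linear z).

Lemma expo_lt0 z f : z < 0 -> expo z f = 0.
Proof. by case: z. Qed.

Lemma expoS b f : expo b.+1 f =
  (c / b.+1%:R) *: \sum_(n < b.+1) Aop (md n) (expo (b%:Z - n%:Z) f).
Proof.
rewrite [LHS]expo_recS; congr (_ *: _); apply: eq_bigr => n _.
by rewrite expo_rec_fuel ?leq_subr // subzn // -ltnS.
Qed.

(** The coefficients of x d/dx exp(h) = (x dh/dx) exp(h). As [expo] vanishes at negative indices,
    every truncation K >= z gives the same sum, and z may be negative. *)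
Lemma expo_euler (z : int) K f : z <= K%:Z ->
  z%:~R *: expo z f =
  c *: \sum_(n < K) Aop (md n) (expo (z - 1 - n%:Z) f).
Proof.
case: z => [b|b] hb; last first.
  by rewrite big1 ?scaler0 // => n _; rewrite expo_lt0 ?linear0 //; lia.
case: b hb => [|b] hb.
  by rewrite scale0r big1 ?scaler0 // => n _; rewrite expo_lt0 ?linear0 //; lia.
rewrite expoS scalerA mulrC divfK ?C_natr_neq0 //; congr (_ *: _).
have le : (b.+1 <= K)%N by lia.
rewrite (big_ord_widen K (fun n => Aop (md n) (expo (b%:Z - n%:Z) f))) //.
rewrite big_mkcond /=; apply: eq_bigr => n _; case: ifP => hn.
  by congr (Aop _ (expo _ _)); lia.
by rewrite expo_lt0 ?linear0 //; lia.
Qed.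

Lemma perm_inv_expo z f : perm_inv f -> perm_inv (expo z f).
Proof.
move=> h; case: z => // b; elim/ltn_ind: b => -[|b] IH //.
rewrite expoS; apply: perm_inv_scale; apply: perm_inv_sum => n.
by apply: perm_inv_A; rewrite subzn -1?ltnS //; apply: IH; lia.
Qed.

Lemma expo_A i z f : perm_inv f ->
  (forall n g, perm_inv g -> Aop i (Aop (md n) g) = Aop (md n) (Aop i g)) ->
  Aop i (expo z f) = expo z (Aop i f).
Proof.
move=> hf h; case: z => [b|b]; last exact: linear0.
elim/ltn_ind: b => -[|b] IH //.
rewrite !expoS linearZ linear_sum; congr (_ *: _); apply: eq_bigr => n _.
rewrite /= h; last exact: perm_inv_expo.
by congr (Aop _ _); rewrite subzn -1?ltnS //; apply: IH; lia.
Qed.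

(** The sign [sg] is 1 for the creation operators in [Eneg] and -1 for the annihilation operators in
    [Epos]. *)
Lemma homog_expo (sg d m z : int) f :
  (forall n, md n = - (sg * n.+1%:Z)) ->
  homog d m f -> homog (d + sg * z) m (expo z f).
Proof.
move=> hmd hf; case: z => [b|b]; last exact: homog0.
elim/ltn_ind: b => -[|b] IH; first by rewrite mulr0 addr0.
rewrite expoS; apply: homogZ; apply: homog_sum => n _.
have nb : (n <= b)%N by rewrite -ltnS.
have -> : d + sg * b.+1%:Z = (d + sg * (b - n)%N%:Z) - md n.
  by rewrite hmd -subzn //; lia.
by apply: homog_A; rewrite subzn //; apply: IH; lia.
Qed.

End Exponential.
Arguments expo : simpl never.

(** Coefficients of z^b in E^-(-j alpha, z) and, for [Epos], of z^(-a) in E^+(-j alpha, z), extended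
    by 0 to negative indices. *)
Definition Eneg (j : int) := expo j%:~R Negz.
Definition Epos (j : int) := expo (- j%:~R) (fun n => Posz n.+1).

HB.instance Definition _ j z := GRing.isLinear.Build C fV fV _ (Eneg j z)
  (@expo_is_linear j%:~R Negz z).
HB.instance Definition _ j z := GRing.isLinear.Build C fV fV _ (Epos j z)
  (@expo_is_linear (- j%:~R) (fun n => Posz n.+1) z).

Lemma coef_Sop (j : int) fuel b v :
  coef (Sop k j fuel b v) = expo_rec j%:~R Negz fuel b (coef v).
Proof.
elim: fuel b => [|fuel IH] b /=; case: eqP => // _; first exact: coef_nil.
rewrite coef_scale coef_flatten; congr (_ *: _); apply: eq_bigr => n _.
by rewrite coef_lin_amode IH.
Qed.

Lemma coef_Top (j : int) fuel b v :
  coef (Top k j fuel b v) =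
  expo_rec (- j%:~R) (fun n => Posz n.+1) fuel b (coef v).
Proof.
elim: fuel b => [|fuel IH] b /=; case: eqP => // _; first exact: coef_nil.
rewrite coef_scale coef_flatten mulNr; congr (_ *: _); apply: eq_bigr => n _.
by rewrite coef_lin_amode IH.
Qed.

(** For s = n+1 the commutator [alpha(-s), -j alpha(s) z^(-s)/s] = 2kj z^(-s) is central, so moving
    alpha(-s) through the exponential adds this scalar. On coefficients this is a strong induction
    along [expo_euler]. *)
Lemma Epos_Aneg (j : int) n z f : perm_inv f ->
  Aop (Negz n) (Epos j z f) =
  Epos j z (Aop (Negz n) f) +
  ((2 * k)%:R * j%:~R) *: Epos j (z - n.+1%:Z) f.
Proof.
move=> hf; case: z => [b|b]; last first.
  by rewrite [Epos _ _ _]expo_lt0 // [X in _ *: X]expo_lt0 ?scaler0 ?addr0 ?linear0 //; lia.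
elim/ltn_ind: b => -[|b] IH.
  by rewrite [X in _ *: X]expo_lt0 ?scaler0 ?addr0 //; lia.
have nz := C_natr_neq0 b.
apply: (scalerI nz); rewrite scalerDr -linearZ /=.
have eu g : b.+1%:R *: Epos j b.+1 g = (- j%:~R) *: \sum_(i < b.+1)
    Aop i.+1 (Epos j (b.+1%:Z - 1 - i%:Z) g).
  exact: (@expo_euler _ _ b.+1).
rewrite !eu linearZ linear_sum /=.
transitivity (- j%:~R *: \sum_(i < b.+1)
   (Aop i.+1 (Epos j (b.+1%:Z - 1 - i%:Z) (Aop (Negz n) f))
    + (((2 * k)%:R * j%:~R) *: Aop i.+1 (Epos j (b.+1%:Z - n.+1%:Z - 1 - i%:Z) f)
    - (i == n :> nat)%:R *: ((2 * k * n.+1)%:R *: Epos j (b.+1%:Z - n.+1%:Z) f)))).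
  congr (_ *: _); apply: eq_bigr => i _.
  have pe : perm_inv (Epos j (b.+1%:Z - 1 - i%:Z) f) by apply: perm_inv_expo.
  have ib : (i <= b)%N by rewrite -ltnS.
  have := Aop_pos_neg i n pe => /esym/(canRL (addrK _)) ->.
  have -> : b.+1%:Z - 1 - i%:Z = (b - i)%N by lia.
  rewrite IH ?linearD ?linearZ /= ?addrA; last by lia.
  have -> : (b - i)%N%:Z - n.+1%:Z = b.+1%:Z - n.+1%:Z - 1 - i%:Z by lia.
  congr (_ + _); case: eqP => [<-|_]; last by rewrite !scale0r.
  by congr (_ *: (_ *: - Epos _ _ _)); lia.
rewrite big_split /= scalerDr; congr (_ + _).
rewrite sumrB scalerBr -scaler_sumr scale_swap -expo_euler; last by lia.
rewrite -/(Epos j (b.+1%:Z - n.+1%:Z) f).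
(* For n > b no i equals n, but then [Epos] on the right has a negative index and vanishes too. *)
have -> : \sum_(i < b.+1) (i == n :> nat)%:R *: ((2 * k * n.+1)%:R *: Epos j (b.+1%:Z - n.+1%:Z) f) =
    (2 * k * n.+1)%:R *: Epos j (b.+1%:Z - n.+1%:Z) f.
  case: (ltnP n b.+1) => nb.
    rewrite (bigD1 (Ordinal nb)) //= eqxx scale1r big1 ?addr0 // => i /negbTE h.
    by have -> : (i == n :> nat) = false by []; rewrite scale0r.
  rewrite [Epos _ _ _]expo_lt0; last by lia.
  by rewrite !scaler0 big1 // => i _; rewrite scaler0.
(* Up to the factor 2kj, the Euler term gives b - n and the central term n + 1, together b + 1. *)
rewrite !scalerA -scalerBl; congr (_ *: _).
rewrite intrD mulrNz !natrM /=; ring.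
Qed.

Lemma homog_Epos j d m z f : homog d m f -> homog (d - z) m (Epos j z f).
Proof.
by move=> h; rewrite -mulN1r; apply: homog_expo h => n; lia.
Qed.

Lemma homog_Eneg j d m z f : homog d m f -> homog (d + z) m (Eneg j z f).
Proof.
by move=> h; rewrite -[z in d + z]mul1r; apply: homog_expo h => n; lia.
Qed.

(** * Modes of e^(j alpha) *)

Lemma sum_shift (H : nat -> fV) i N :
  (forall a, (a < i)%N -> H a = 0) -> (forall a, (N <= a)%N -> H a = 0) ->
  \sum_(a < N) H (a + i)%N = \sum_(a < N) H a.
Proof.
move=> lo hi.
rewrite -(big_mkord xpredT (fun a => H (a + i)%N)) -(big_mkord xpredT H).
have -> : \sum_(0 <= a < N) H (a + i)%N = \sum_(0 + i <= a < N + i) H a.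
  by rewrite big_addn addnK.
rewrite add0n; transitivity (\sum_(0 <= a < N + i) H a).
  rewrite [RHS](@big_cat_nat _ _ _ i) ?leq_addl //= [X in _ = X + _]big_nat_cond.
  by rewrite [X in X + _]big1 ?add0r // => a /andP[/andP[_ h] _]; apply: lo.
rewrite (@big_cat_nat _ _ _ N) ?leq_addr //= [X in _ + X]big_nat_cond.
by rewrite [X in _ + X]big1 ?addr0 // => a /andP[/andP[h _] _]; apply: hi.
Qed.

(** The formula of [evmode] on a g already moved to charge m + j. The free truncation N lets vectors
    of different Fock degree share one range; the sign test of [evmode] is absorbed by [Eneg]. *)
Definition evop (j n m : int) N (g : fV) : fV :=
  \sum_(a < N) Eneg j (a%:Z - n - 1 - (2 * k)%:Z * j * m) (Epos j a%:Z g).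

Lemma Epos_delta0 j a b : (fdeg b.1 < a)%N -> Epos j a%:Z (delta b) = 0.
Proof.
move=> h; have hh := @homog_Epos j _ _ a%:Z _ (@homog_delta b).
by apply: (homog_neg hh); lia.
Qed.

Lemma coef_evmode j n p m N : (fdeg p < N)%N ->
  coef (evmode k j n (p, m)) = evop j n m N (delta (p, m + j)).
Proof.
move=> hN; pose bb (a : nat) : int := a%:Z - n - 1 - (2 * k)%:Z * j * m.
pose F (a : nat) : fV := coef (if 0 <= bb a
  then Sop k j `|bb a| `|bb a| (Top k j a a (bvec (p, m + j))) else [::]).
rewrite coef_flatten (sum_iota _ F) (big_ord_widen N F) // big_mkcond.
apply: eq_bigr => a _; rewrite /F; case: ifP => ha; last first.
  rewrite Epos_delta0 /=; last by move: ha => /=; lia.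
  by rewrite linear0.
case: ifP => hb; last first.
  by rewrite coef_nil [RHS]expo_lt0 // ltNge hb.
by rewrite coef_Sop coef_Top -[X in Eneg _ X](gez0_abs hb).
Qed.

Lemma evop_linear j n m N : linear (evop j n m N).
Proof.
move=> c f g; rewrite scaler_sumr -big_split /=; apply: eq_bigr => a _.
by rewrite !linearP.
Qed.
HB.instance Definition _ j n m N :=
  GRing.isLinear.Build C fV fV _ (evop j n m N) (@evop_linear j n m N).

Lemma homog_evmode j n p m :
  homog ((fdeg p)%:Z - n - 1 - (2 * k)%:Z * j * m) (m + j)
    (coef (evmode k j n (p, m))).
Proof.
rewrite (@coef_evmode _ _ _ _ (fdeg p).+1) //; apply: homog_sum => a _.
have -> : (fdeg p)%:Z - n - 1 - (2 * k)%:Z * j * m =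
  (fdeg p)%:Z - a%:Z + (a%:Z - n - 1 - (2 * k)%:Z * j * m) by ring.
by apply: homog_Eneg; apply: homog_Epos; apply: (@homog_delta (p, m + j)).
Qed.

Lemma coef_evmode_amode j n i p m N : (fdeg p < N)%N ->
  coef (lin (evmode k j n) (amode k (Posz i.+1) (p, m))) =
  evop j n m N (Aop (Posz i.+1) (delta (p, m + j))).
Proof.
move=> hN; rewrite coef_lin big_seq1 -coef_amode [coef (amode _ _ _)]coef_delta big_seq1 linearZ /=.
case: (boolP (i \in p)) => ip; last by rewrite (count_memPn ip) muln0 !scale0r.
by rewrite (@coef_evmode _ _ _ _ N) //; move: hN; rewrite (fdeg_rem ip); lia.
Qed.

(** alpha(-n-1) commutes with E^- and passes E^+ by [Epos_Aneg]; the shift of the index of E^+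
    becomes a shift of the mode after reindexing a. *)
Lemma Aneg_evmode n j l p m :
  Aop (Negz n) (coef (evmode k j l (p, m))) =
  coef (evmode k j l (n :: p, m)) +
  ((2 * k)%:R * j%:~R) *: (coef (evmode k j (l - n.+1%:Z) (p, m)) : fV).
Proof.
pose N := (fdeg (n :: p)).+1.
have hN : (fdeg p < N)%N by rewrite /N fdeg_cons; lia.
rewrite !(@coef_evmode _ _ _ _ N) // linear_sum scaler_sumr /=.
pose H (a : nat) := ((2 * k)%:R * j%:~R) *: Eneg j (a%:Z - l - 1 - (2 * k)%:Z * j * m)
    (Epos j (a%:Z - n.+1%:Z) (delta (p, m + j))).
transitivity (evop j l m N (delta (n :: p, m + j)) + \sum_(a < N) H a).
  rewrite -big_split /=; apply: eq_bigr => a _.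
  have pd := @perm_inv_delta (p, m + j).
  rewrite expo_A; first last.
  - by move=> i g; apply: Aop_neg_comm.
  - exact: perm_inv_expo.
  rewrite Epos_Aneg // linearD linearZ /=; congr (Eneg _ _ (Epos _ _ _) + _).
  by rewrite -coef_amode [coef (amode _ _ _)]coef_delta big_seq1 scale1r.
congr (_ + _); rewrite -(@sum_shift H n.+1).
- apply: eq_bigr => a _; congr (_ *: Eneg _ _ (Epos _ _ _)); lia.
- by move=> a ha; rewrite /H [Epos _ _ _]expo_lt0 ?linear0 ?scaler0 //; lia.
move=> a ha; rewrite /H -[_ - n.+1%:Z]/(_) subzn; last by rewrite /N fdeg_cons in ha; lia.
rewrite Epos_delta0 ?linear0 ?scaler0 //=.
by rewrite /N fdeg_cons in ha; lia.
Qed.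

(** The derivative of Y(e^(j alpha), z) is the normally ordered product of j alpha(z) with it,
    truncated at K. On the summand a, with M = 2kjm, the Euler identity for E^- gives a - n - M,
    alpha(0) gives M and the Euler identity for E^+ gives -a: in total -n. *)
Lemma evmode_deriv j n p m K :
  (fdeg p + `|n| + `|((2 * k)%:Z * j * m)%R| < K)%N ->
  j%:~R *: (\sum_(i < K) Aop (Negz i) (coef (evmode k j (n + i%:Z) (p, m))) +
    \sum_(i < K) (coef (lin (evmode k j (n - 1 - i%:Z)) (amode k i%:Z (p, m))) : fV)) =
  (- n%:~R) *: (coef (evmode k j (n - 1) (p, m)) : fV).
Proof.
case: K => // K hK; set M := (2 * k)%:Z * j * m in hK.
pose N := (fdeg p).+1; set g := delta (p, m + j).
pose F (a : nat) := Eneg j (a%:Z - n - M) (Epos j a%:Z g).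
have evF : coef (evmode k j (n - 1) (p, m)) = \sum_(a < N) F a.
  rewrite (@coef_evmode _ _ _ _ N) //; apply: eq_bigr => a _.
  by congr (Eneg _ _ _); rewrite /M; lia.
have pg : perm_inv g by apply: perm_inv_delta.
have s1 : j%:~R *: (\sum_(i < K.+1) Aop (Negz i) (coef (evmode k j (n + i%:Z) (p, m)))) =
    \sum_(a < N) (a%:Z - n - M)%:~R *: F a.
  transitivity (j%:~R *: \sum_(i < K.+1) \sum_(a < N) Aop (Negz i)
      (Eneg j (a%:Z - n - M - 1 - i%:Z) (Epos j a%:Z g))).
    congr (_ *: _); apply: eq_bigr => i _.
    rewrite (@coef_evmode _ _ _ _ N) // linear_sum; apply: eq_bigr => a _.
    by congr (Aop _ (Eneg _ _ _)); rewrite /M; lia.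
  rewrite exchange_big /= scaler_sumr; apply: eq_bigr => a _.
  rewrite -expo_euler //; have := ltn_ord a; rewrite /N; lia.
have s2 : j%:~R *: (\sum_(i < K) (coef (lin (evmode k j (n - 1 - i.+1%:Z))
      (amode k i.+1%:Z (p, m))) : fV)) = \sum_(a < N) (- a%:R) *: F a.
  transitivity (j%:~R *: \sum_(i < K) \sum_(a < N) Eneg j (a%:Z - n - M)
      (Aop i.+1 (Epos j (a%:Z - 1 - i%:Z) g))).
    congr (_ *: _); apply: eq_bigr => i _.
    rewrite (@coef_evmode_amode _ _ _ _ _ N) //.
    (* The mode n - 1 - (i+1) displaces a by i+1; reindexing gives E^- the same index for all i. *)
    rewrite -[RHS](@sum_shift (fun a => Eneg j (a%:Z - n - M)
      (Aop i.+1 (Epos j (a%:Z - 1 - i%:Z) g))) i.+1).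
    - apply: eq_bigr => a _; rewrite /Epos -expo_A //; last first.
        by move=> l f hf; apply: Aop_pos_comm.
      by congr (Eneg _ _ (Aop _ (expo _ _ _ _))); rewrite /M; lia.
    - by move=> a ha; rewrite [Epos _ _ _]expo_lt0 ?linear0 //; lia.
    move=> a ha; suff -> : Aop i.+1 (Epos j (a%:Z - 1 - i%:Z) g) = 0 by rewrite linear0.
    have hh := homog_A (n := i.+1) (@homog_Epos j _ _ (a%:Z - 1 - i%:Z) _ (@homog_delta (p, m + j))).
    by apply: (homog_neg hh); rewrite /=; lia.
  rewrite exchange_big /= scaler_sumr; apply: eq_bigr => a _.
  have eu : a%:R *: Epos j a%:Z g =
      - j%:~R *: \sum_(i < K) Aop i.+1 (Epos j (a%:Z - 1 - i%:Z) g).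
    apply: (@expo_euler (- j%:~R) (fun n => Posz n.+1) a%:Z).
    by have := ltn_ord a; rewrite /N; lia.
  rewrite -linear_sum -linearZ /=; have -> : j%:~R *: \sum_(i < K)
      Aop i.+1 (Epos j (a%:Z - 1 - i%:Z) g) = (- a%:R) *: Epos j a%:Z g.
    by rewrite scaleNr eu -scaleNr opprK.
  by rewrite linearZ.
pose G (i : nat) : fV :=
  coef (lin (evmode k j (n - 1 - i%:Z)) (amode k i%:Z (p, m))).
have s3 : \sum_(i < K.+1) G i = G 0%N + \sum_(i < K) G i.+1.
  exact: big_ord_recl.
rewrite scalerDr s1 s3 scalerDr s2 /G coef_lin big_seq1 /= subr0 evF.
rewrite !scalerA !scaler_sumr.
rewrite -!big_split /=; apply: eq_bigr => a _; rewrite -!scalerDl; congr (_ *: _).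
rewrite /M !rmorphB !rmorphM /=; ring.
Qed.

(** * Modes of arbitrary vectors *)

Lemma lin_amode_pos (F : key -> vec) i p m :
  coef (lin F (amode k (Posz i.+1) (p, m))) =
  if i \in p then (2 * k * i.+1 * count_mem i p)%:R *: (coef (F (rem i p, m)) : fV)
  else 0.
Proof.
rewrite coef_lin big_seq1 /=; case: ifP => // /negbT /count_memPn ->.
by rewrite muln0 scale0r.
Qed.

Lemma homog_lin_amode (F : key -> vec) (d e : int) i w :
  (forall w', w'.2 = w.2 -> homog (d + (fdeg w'.1)%:Z) e (coef (F w'))) ->
  homog (d + (fdeg w.1)%:Z - i%:Z) e (coef (lin F (amode k i%:Z w))).
Proof.
case: w => p m h; case: i => [|i].
  by rewrite coef_lin big_seq1 subr0; apply: homogZ; apply: h.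
rewrite lin_amode_pos; case: ifP => [ip|_]; last exact: homog0.
have -> : d + (fdeg (p, m).1)%:Z - i.+1%:Z = d + (fdeg (rem i p))%:Z.
  by rewrite /= (fdeg_rem ip); lia.
by apply: homogZ; apply: h.
Qed.

Lemma lin_amode_gt (F : key -> vec) i w : (fdeg w.1 < i)%N ->
  coef (lin F (amode k i%:Z w)) = 0 :> fV.
Proof.
case: i w => [|i] [p m] //= hi; rewrite lin_amode_pos; case: ifP => // ip.
by move: hi; rewrite (fdeg_rem ip); lia.
Qed.

Lemma coef_mode_cons i p j s w : coef (mode k (i :: p) j s w) =
  \sum_(l < wt k (p, j) + wt k w + absz s)
    'C(i + l, l)%:R *: Aop (- (i.+1 + l)%N%:Z) (coef (mode k p j (s + l%:Z) w)) +
  \sum_(l < (fdeg w.1).+1)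
    (- ((-1) ^+ i.+1 * 'C(i + l, l)%:R)) *:
      (coef (lin (mode k p j (s - i.+1%:Z - l%:Z)) (amode k l%:Z w)) : fV).
Proof.
rewrite coef_cat !coef_flatten !sum_iota.
by congr (_ + _); apply: eq_bigr => l _;
  rewrite coef_scale ?coef_lin_amode addSn subn1.
Qed.

(** The rule wt(u_s w) = wt u + wt w - s - 1 in terms of Fock degrees: k(j+m)^2 exceeds k j^2 + k
    m^2 by 2kjm. *)
Lemma homog_mode p j s w :
  homog ((fdeg p)%:Z + (fdeg w.1)%:Z - s - 1 - (2 * k)%:Z * j * w.2) (w.2 + j)
    (coef (mode k p j s w)).
Proof.
elim: p s w => [|i p IH] s w.
  by case: w => p m; rewrite {1}/fdeg big_nil add0r; apply: homog_evmode.
rewrite coef_mode_cons; apply: homogD; apply: homog_sum => l _; apply: homogZ.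
  have -> : (fdeg (i :: p))%:Z + (fdeg w.1)%:Z - s - 1 - (2 * k)%:Z * j * w.2 =
    ((fdeg p)%:Z + (fdeg w.1)%:Z - (s + l%:Z) - 1 - (2 * k)%:Z * j * w.2) - - (i.+1 + l)%N%:Z.
    by rewrite fdeg_cons; lia.
  by apply: homog_A; apply: IH.
have -> : (fdeg (i :: p))%:Z + (fdeg w.1)%:Z - s - 1 - (2 * k)%:Z * j * w.2 =
  ((fdeg p)%:Z - (s - i.+1%:Z - l%:Z) - 1 - (2 * k)%:Z * j * w.2) + (fdeg w.1)%:Z - l%:Z.
  by rewrite fdeg_cons; lia.
apply: homog_lin_amode => w' e; rewrite -e.
have -> : (fdeg p)%:Z - (s - i.+1%:Z - l%:Z) - 1 - (2 * k)%:Z * j * w'.2 + (fdeg w'.1)%:Z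
  = (fdeg p)%:Z + (fdeg w'.1)%:Z - (s - i.+1%:Z - l%:Z) - 1 - (2 * k)%:Z * j * w'.2 by ring.
exact: IH.
Qed.

(** The Fock degree given by [homog_mode] is then at most -1 - k(j + w.2)^2. *)
Lemma mode_vanish p j s w : (wt k (p, j))%:Z + (wt k w)%:Z <= s ->
  coef (mode k p j s w) = 0 :> fV.
Proof.
move=> h; apply: (homog_neg (@homog_mode p j s w)); move: h; rewrite /wt /=.
have e (x : int) : (k * `|x| ^ 2)%N%:Z = k%:Z * x ^+ 2.
  by rewrite PoszM -abszX gez0_abs ?sqr_ge0.
rewrite !PoszD !e.
have -> : (2 * k)%:Z * j * w.2 =
    k%:Z * (j + w.2) ^+ 2 - k%:Z * j ^+ 2 - k%:Z * w.2 ^+ 2 by rewrite PoszM; ring.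
have : 0 <= k%:Z * (j + w.2) ^+ 2 by rewrite mulr_ge0 ?sqr_ge0.
lia.
Qed.

(** The truncations inside [mode] vary with the vectors and with s. A common bound N makes iterate
    formulas comparable term by term; the added terms vanish by [mode_vanish] and [lin_amode_gt]. *)
Lemma mode_consE N i p j s w :
  (wt k (p, j) + wt k w + absz s <= N)%N -> (fdeg w.1 < N)%N ->
  coef (mode k (i :: p) j s w) =
  \sum_(l < N)
    'C(i + l, l)%:R *: Aop (- (i.+1 + l)%N%:Z) (coef (mode k p j (s + l%:Z) w)) +
  \sum_(l < N)
    (- ((-1) ^+ i.+1 * 'C(i + l, l)%:R)) *:
      (coef (lin (mode k p j (s - i.+1%:Z - l%:Z)) (amode k l%:Z w)) : fV).
Proof.
move=> h1 h2; rewrite coef_mode_cons; congr (_ + _).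
  pose F (l : nat) := 'C(i + l, l)%:R *:
    Aop (- (i.+1 + l)%N%:Z) (coef (mode k p j (s + l%:Z) w)).
  rewrite (big_ord_widen N F) // big_mkcond; apply: eq_bigr => l _.
  by case: ifP => // hl; rewrite /F mode_vanish ?linear0 ?scaler0 //; lia.
pose F (l : nat) : fV := (- ((-1) ^+ i.+1 * 'C(i + l, l)%:R)) *:
  (coef (lin (mode k p j (s - i.+1%:Z - l%:Z)) (amode k l%:Z w)) : fV).
rewrite (big_ord_widen N F) // big_mkcond; apply: eq_bigr => l _.
by case: ifP => // hl; rewrite /F lin_amode_gt ?scaler0 //; lia.
Qed.

Definition umode (u : vec) (s : int) (w : key) : fV :=
  \sum_(t <- u) t.1 *: (coef (mode k t.2.1 t.2.2 s w) : fV).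

Lemma coef_vmode u s v :
  coef (vmode k u s v) = \sum_(t <- v) t.1 *: umode u s t.2.
Proof.
rewrite coef_flatten.
under eq_bigr => t _ do rewrite coef_scale coef_lin scaler_sumr.
rewrite exchange_big; apply: eq_bigr => t _ /=; rewrite scaler_sumr.
by apply: eq_bigr => t' _; rewrite scale_swap.
Qed.

End Operators.
Arguments expo : simpl never.

(** * Translation *)

(* L(-1) on basis vectors, i.e. the derivation d of M(1) (x) C[L] with
   d alpha(-n) = n alpha(-n-1) and d e^(j alpha) = j alpha(-1) e^(j alpha). *)
Fixpoint Dseq (p : seq nat) (j : int) : vec :=
  if p is i :: p' then
    (i.+1%:R, (i.+1 :: p', j)) ::
      [seq (t.1, (i :: t.2.1, t.2.2)) | t <- Dseq p' j]
  else [:: (j%:~R, ([:: 0%N], j))].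

Definition Dkey (b : key) : vec := Dseq b.1 b.2.

Lemma Dseq_wt k p j t :
  t \in Dseq p j -> t.2.2 = j /\ wt k t.2 = (wt k (p, j)).+1.
Proof.
rewrite /wt; elim: p t => [|i p IH] t /=.
  by rewrite inE => /eqP -> /=; rewrite fdeg_cons; split=> //; lia.
rewrite inE => /predU1P[-> /=|]; first by rewrite !fdeg_cons; split=> //; lia.
case/mapP => t' /IH [h1 /= h2] -> /=; split=> //.
by rewrite !fdeg_cons -addnA h2; lia.
Qed.

Section Translation.
Variable k : nat.

Lemma umode_cons c b u s w :
  umode k ((c, b) :: u) s w = c *: (coef (mode k b.1 b.2 s w) : fV) + umode k u s w.
Proof. by rewrite /umode big_cons. Qed.

(** Induction along the iterate formula: the base is [evmode_deriv], and the step reduces to two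
    binomial identities, one for each sum of the formula. *)
Lemma umode_Dseq p j s w :
  umode k (Dseq p j) s w = (- s%:~R) *: (coef (mode k p j (s - 1) w) : fV).
Proof.
elim: p s w => [|i p IH] s [q m].
  pose N := (wt k ([::], j) + wt k (q, m) + absz s +
    (fdeg q + `|s| + `|((2 * k)%:Z * j * m)%R|)).+1.
  rewrite umode_cons [umode _ [::] _ _]/umode big_nil addr0 /=.
  rewrite (@mode_consE k N); first last.
  - by rewrite /= /N; lia.
  - by rewrite /N; lia.
  rewrite -(@evmode_deriv k j s q m N); last by rewrite /N; lia.
  congr (_ *: (_ + _)); apply: eq_bigr => l _; rewrite add0n binn.
    by rewrite scale1r.
  by rewrite expr1 mulr1 opprK scale1r.
(* Large enough for every mode expanded below, including those at s - 1, and for the tail of the sum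
   shifted by one. *)
pose N := (wt k (i.+1 :: p, j) + wt k (q, m) + absz s + fdeg q).+3.
have Nw := @Dseq_wt k p j.
have wt_cons l : wt k (l :: p, j) = (l.+1 + wt k (p, j))%N.
  by rewrite /wt /= fdeg_cons addnA.
have wt_consi : wt k (i.+1 :: p, j) = (i.+2 + wt k (p, j))%N by apply: wt_cons.
rewrite umode_cons /=.
pose X (x : int) : fV := coef (mode k p j x (q, m)).
pose Y (x : int) (l : nat) : fV := coef (lin (mode k p j x) (amode k l%:Z (q, m))).
(* Here L(-1) hits the tail p: the induction hypothesis turns each mode t into -t times the mode t -
   1, with t = s + l in the first sum and t = s - i - 1 - l in the second. *)
have -> : umode k [seq (t.1, (i :: t.2.1, t.2.2)) | t <- Dseq p j] s (q, m) =
    \sum_(l < N) ('C(i + l, l)%:R * - (s + l%:Z)%:~R) *: Aop k (- (i.+1 + l)%N%:Z) (X (s + l%:Z - 1)) +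
    \sum_(l < N) (- ((-1) ^+ i.+1 * 'C(i + l, l)%:R) * - (s - i.+1%:Z - l%:Z)%:~R) *:
       Y (s - i.+1%:Z - l%:Z - 1) l.
  transitivity (\sum_(t <- Dseq p j) t.1 *: (
    \sum_(l < N) 'C(i + l, l)%:R *: Aop k (- (i.+1 + l)%N%:Z)
        (coef (mode k t.2.1 t.2.2 (s + l%:Z) (q, m))) +
    \sum_(l < N) (- ((-1) ^+ i.+1 * 'C(i + l, l)%:R)) *:
      (coef (lin (mode k t.2.1 t.2.2 (s - i.+1%:Z - l%:Z)) (amode k l%:Z (q, m))) : fV))).
    rewrite /umode big_map; apply: eq_big_seq => t /Nw [_ e] /=.
    congr (_ *: _); apply: mode_consE; last by rewrite /N /=; lia.
    by rewrite -surjective_pairing e /N; lia.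
  under eq_bigr => t _ do rewrite scalerDr !scaler_sumr.
  rewrite big_split /= [X in X + _]exchange_big [X in _ + X]exchange_big /=.
  congr (_ + _); apply: eq_bigr => l _.
    have swap a c n (x : fV) : a *: (c *: Aop k n x) = c *: Aop k n (a *: x).
      by rewrite scale_swap [Aop k n (_ *: _)]linearZ.
    under eq_bigr => t _ do rewrite swap.
    rewrite -scaler_sumr -linear_sum -[LHS]/(_ *: Aop k _ (umode k _ _ _)).
    by rewrite IH -scalerA [Aop k _ (_ *: _)]linearZ.
  under eq_bigr => t _ do rewrite scale_swap.
  rewrite -scaler_sumr -scalerA; congr (_ *: _); rewrite /Y coef_lin scaler_sumr.
  under eq_bigr => t _ do rewrite coef_lin scaler_sumr.
  rewrite exchange_big; apply: eq_bigr => t _ /=.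
  under eq_bigr => t' _ do rewrite scale_swap.
  by rewrite -scaler_sumr scale_swap -IH.
rewrite (@mode_consE k N (i.+1)); first last.
- by rewrite /N /=; lia.
- by rewrite /N; lia.
rewrite (@mode_consE k N i); first last.
- by rewrite /N /=; lia.
- by rewrite /N; lia.
rewrite !scalerDr !scaler_sumr addrACA; congr (_ + _); last first.
  rewrite -big_split /=; apply: eq_bigr => l _.
  have -> : s - i.+2%:Z - l%:Z = s - i.+1%:Z - l%:Z - 1 by lia.
  have -> : s - 1 - i.+1%:Z - l%:Z = s - i.+1%:Z - l%:Z - 1 by lia.
  rewrite -/(Y _ _) !scalerA -scalerDl; congr (_ *: _).
  (* (i+1) C(i+l+1, l) = (i+l+1) C(i+l, l), so the scalars i+l+1 and s-i-1-l add up to s. *)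
  have := mul_bin_down (i.+1 + l) l; rewrite addnK addSn /=.
  move/(congr1 (fun x : nat => x%:R : C)); rewrite !natrM => e.
  rewrite !rmorphB /= (exprS _ i.+1); move: ((-1) ^+ i.+1) => sg.
  transitivity (sg * (i.+1%:R * 'C((i + l).+1, l)%:R) +
    sg * 'C(i + l, l)%:R * (s%:~R - i.+1%:R - l%:R)); first by ring.
  by rewrite -e -addSn natrD; ring.
(* The operator alpha(-i-2-l) has index l+1 relative to alpha(-i-1), and (i+1) C(i+1+l, l) = (l+1)
   C(i+1+l, l+1); the first sum is thus that of H shifted by one, and l - (s + l) = -s. *)
pose H (l : nat) := (l * 'C(i + l, l))%:R *: Aop k (- (i.+1 + l)%N%:Z) (X (s + l%:Z - 1)).
transitivity (\sum_(l < N) H l + \sum_(l < N)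
   ('C(i + l, l)%:R * - (s + l%:Z)%:~R) *: Aop k (- (i.+1 + l)%N%:Z) (X (s + l%:Z - 1))); last first.
  rewrite -big_split /=; apply: eq_bigr => l _.
  have -> : s - 1 + l%:Z = s + l%:Z - 1 by lia.
  rewrite -/(X _) !scalerA -scalerDl; congr (_ *: _).
  rewrite rmorphD natrM /=; ring.
congr (_ + _); rewrite -(@sum_shift H 1).
- apply: eq_bigr => l _; rewrite /H scalerA -natrM addn1 mul_bin_left.
  congr (_%:R *: Aop _ _ (X _)); last by lia.
  + by congr muln; [lia | congr 'C(_, _); lia].
  by lia.
- by case=> // _; rewrite /H mul0n scale0r.
move=> l hl; rewrite /H /X mode_vanish ?linear0 ?scaler0 //.
by move: hl; rewrite /N; lia.
Qed.

Definition Dlin (u : vec) : vec := lin Dkey u.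

Lemma umode_Dlin u s w : umode k (Dlin u) s w = (- s%:~R) *: umode k u (s - 1) w.
Proof.
rewrite /umode big_flatten big_map scaler_sumr; apply: eq_bigr => t _.
rewrite big_map scale_swap -umode_Dseq scaler_sumr; apply: eq_bigr => t' _.
by rewrite scalerA.
Qed.

(** The constant is (-s)(1-s)...(r-1-s), nonzero because s < 0, and the same for all u and w. *)
Lemma umode_iter_Dlin r (s : int) : s < 0 ->
  exists2 c : C, c != 0 &
    forall u w, umode k (iter r Dlin u) s w = c *: umode k u (s - r%:Z) w.
Proof.
elim: r s => [|r IH] s s0.
  by exists 1; rewrite ?oner_eq0 // => u w; rewrite subr0 scale1r.
have [|c c0 h] := IH (s - 1); first by lia.
exists (- s%:~R * c) => [|u w].
  rewrite mulf_neq0 // oppr_eq0; case: s s0 {h} => // n _.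
  by rewrite NegzE mulrNz oppr_eq0 C_natr_neq0.
by rewrite umode_Dlin h scalerA; congr (_ *: umode _ _ _ _); lia.
Qed.

End Translation.

(** * The involution theta *)

Definition Theta (f : fV) : fV := fun b => (-1) ^+ size b.1 * f (b.1, - b.2).

Lemma Theta_is_linear : linear Theta.
Proof.
by move=> c f g; apply: fV_ext => b; rewrite fVDE fVZE /Theta fVDE fVZE mulrDr mulrCA.
Qed.
HB.instance Definition _ := GRing.isLinear.Build C fV fV _ Theta Theta_is_linear.

Lemma Theta_delta p m : Theta (delta (p, m)) = (-1) ^+ size p *: delta (p, - m).
Proof.
apply: fV_ext => -[q m']; rewrite fVZE /Theta !deltaE /= eqr_oppLR.
by case: (boolP (perm_eq p q)) => [/perm_size ->|_] //; rewrite !mulr0.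
Qed.

Lemma ThetaK f : Theta (Theta f) = f.
Proof.
apply: fV_ext => -[q m]; rewrite /Theta /= opprK mulrA -exprD addnn -mul2n.
by rewrite exprM sqrrN expr1n expr1n mul1r.
Qed.

Lemma coef_theta v : coef (lin theta v) = Theta (coef v).
Proof.
rewrite coef_lin [in RHS]coef_delta linear_sum; apply: eq_bigr => -[c [p m]] _.
by rewrite /= [Theta (_ *: _)]linearZ /= Theta_delta [coef _]coef_delta big_seq1.
Qed.

Lemma in_VLplusE v : in_VLplus v <-> Theta (coef v) = coef v.
Proof. by rewrite /in_VLplus vequivE coef_theta. Qed.

Section ThetaModes.
Variable k : nat.

Lemma Theta_A n f : Theta (Aop k n f) = - Aop k n (Theta f).
Proof.
apply: fV_ext => -[p m]; rewrite -[RHS]/(- (Aop k n (Theta f) (p, m))) /Theta.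
case: n => [[|n]|n] /=.
- by rewrite mulrNz; ring.
- by rewrite exprS; ring.
case: ifP => np; last by rewrite mulr0 oppr0.
by rewrite (perm_size (perm_to_rem np)) /= exprS; ring.
Qed.

Lemma Theta_expo c md z f :
  Theta (expo k c md z f) = expo k (- c) md z (Theta f).
Proof.
case: z => [b|b]; last exact: linear0.
elim/ltn_ind: b => -[|b] IH //.
rewrite !expoS linearZ linear_sum mulNr scaleNr -scalerN -sumrN.
congr (_ *: _); apply: eq_bigr => n _.
by rewrite /= Theta_A subzn -1?ltnS // IH //; lia.
Qed.

(** Conjugation by theta negates each alpha(n), hence replaces j by -j in both exponentials; the
    product jm in the power of z is unchanged. *)
Lemma Theta_evmode j n p m :
  Theta (coef (evmode k j n (p, m))) =
  (-1) ^+ size p *: (coef (evmode k (- j) n (p, - m)) : fV).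
Proof.
rewrite !(@coef_evmode _ _ _ _ _ (fdeg p).+1) // linear_sum scaler_sumr.
apply: eq_bigr => a _ /=.
rewrite /Eneg /Epos !Theta_expo.
rewrite Theta_delta !linearZ /= -!rmorphN /=.
by rewrite opprD; congr (_ *: expo _ _ _ _ _); ring.
Qed.

End ThetaModes.

Lemma lin_thetaE v :
  lin theta v = [seq (t.1 * (-1) ^+ size t.2.1, (t.2.1, - t.2.2)) | t <- v].
Proof.
by elim: v => // t v IH; rewrite -[LHS]/(_ :: lin theta v) IH.
Qed.

Lemma vscaleA a b u : vscale a (vscale b u) = vscale (a * b) u.
Proof. by rewrite /vscale -map_comp; apply: eq_map => t /=; rewrite mulrA. Qed.

Lemma theta_Dseq p j :
  lin theta (Dseq p j) = vscale ((-1) ^+ size p) (Dseq p (- j)).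
Proof.
elim: p => [|i p IH].
  by rewrite lin_thetaE /= expr0 expr1 mul1r mulrN1 mulrNz.
move: IH; rewrite !lin_thetaE /= => IH.
congr (_ :: _); first by rewrite mulrC.
rewrite -map_comp [RHS](_ : _ = [seq (- t.1, (i :: t.2.1, t.2.2)) |
    t <- vscale ((-1) ^+ size p) (Dseq p (- j))]).
  by rewrite -IH -map_comp; apply: eq_map => t /=; rewrite exprS mulN1r mulrN.
rewrite /vscale -!map_comp; apply: eq_map => t /=.
by rewrite exprS mulN1r mulNr.
Qed.

(** Theta commutes with L(-1). Being an equality of lists, this can be rewritten under [iter]. *)
Lemma theta_Dlin u : lin theta (Dlin u) = Dlin (lin theta u).
Proof.
elim: u => // -[c [p j]] u IH.
have -> : Dlin ((c, (p, j)) :: u) = vscale c (Dseq p j) ++ Dlin u by [].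
have lc x y : lin theta (x ++ y) = lin theta x ++ lin theta y.
  by rewrite !lin_thetaE map_cat.
have lz a x : lin theta (vscale a x) = vscale a (lin theta x).
  by rewrite !lin_thetaE /vscale -!map_comp; apply: eq_map => t /=; rewrite mulrA.
by rewrite lc lz IH theta_Dseq vscaleA.
Qed.

(** * Generation modulo C_2 *)

Definition good (k : nat) (f : fV) : Prop :=
  exists x y z, [/\ in_M1plus x, in_VLplus1 y, in_C2_VLplus k z
    & f = (coef x : fV) + coef y + coef z].

(** * Closure properties of the three summands *)

Lemma in_M1D x y : in_M1 x -> in_M1 y -> in_M1 (x ++ y).
Proof. by move=> hx hy b hb; rewrite coef_cat fVDE hx ?hy ?addr0. Qed.

Lemma in_M1Z c x : in_M1 x -> in_M1 (vscale c x).
Proof. by move=> hx b hb; rewrite coef_scale fVZE hx ?mulr0. Qed.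

Lemma in_M1plusE x : in_M1plus x <-> in_M1 x /\ Theta (coef x) = coef x.
Proof. by rewrite /in_M1plus vequivE coef_theta. Qed.

Lemma in_M1minusE x : in_M1minus x <-> in_M1 x /\ Theta (coef x) = - (coef x : fV).
Proof. by rewrite /in_M1minus vequivE coef_theta coef_scale scaleN1r. Qed.

Lemma coef_tensor_e u m b : coef (tensor_e u m) b = coef u (b.1, b.2 - m).
Proof.
by rewrite /coef big_map; apply: eq_bigl => t /=; rewrite [in RHS]eq_sym subr_eq eq_sym.
Qed.

Lemma in_VLplus1D x y : in_VLplus1 x -> in_VLplus1 y -> in_VLplus1 (x ++ y).
Proof.
move=> [u1 [u2 [/in_M1plusE[h1 t1] [/in_M1minusE[h2 t2] /vequivE e]]]].
move=> [v1 [v2 [/in_M1plusE[h3 t3] [/in_M1minusE[h4 t4] /vequivE e']]]].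
exists (u1 ++ v1), (u2 ++ v2); split; [|split].
- by apply/in_M1plusE; split; [exact: in_M1D | rewrite coef_cat linearD /= t1 t3].
- apply/in_M1minusE; split; first exact: in_M1D.
  by rewrite coef_cat linearD /= t2 t4 opprD.
apply/vequivE; rewrite coef_cat e e'; apply: fV_ext => b.
rewrite !(coef_cat, coef_scale) !(fVDE, fVZE) !coef_tensor_e !coef_cat !fVDE; ring.
Qed.

Lemma in_VLplus1Z c x : in_VLplus1 x -> in_VLplus1 (vscale c x).
Proof.
move=> [u1 [u2 [/in_M1plusE[h1 t1] [/in_M1minusE[h2 t2] /vequivE e]]]].
exists (vscale c u1), (vscale c u2); split; [|split].
- by apply/in_M1plusE; split; [exact: in_M1Z | rewrite coef_scale linearZ /= t1].
- apply/in_M1minusE; split; first exact: in_M1Z.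
  by rewrite coef_scale linearZ /= t2 scalerN.
apply/vequivE; rewrite coef_scale e; apply: fV_ext => b.
rewrite !(coef_cat, coef_scale) !(fVDE, fVZE) !coef_tensor_e !coef_scale !fVZE; ring.
Qed.

Lemma goodD k f g : good k f -> good k g -> good k (f + g).
Proof.
move=> [x [y [z [/in_M1plusE[hx tx] hy [l [hl /vequivE hz]] ->]]]].
move=> [x' [y' [z' [/in_M1plusE[hx' tx'] hy' [l' [hl' /vequivE hz']] ->]]]].
exists (x ++ x'), (y ++ y'), (z ++ z'); split.
- by apply/in_M1plusE; split; [exact: in_M1D | rewrite coef_cat linearD /= tx tx'].
- exact: in_VLplus1D.
- exists (l ++ l'); split; first by move=> t; rewrite mem_cat => /orP[/hl|/hl'].
  by apply/vequivE; rewrite map_cat flatten_cat !coef_cat hz hz'.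
rewrite !coef_cat; apply: fV_ext => b; rewrite !fVDE; ring.
Qed.

Lemma goodZ k c f : good k f -> good k (c *: f).
Proof.
move=> [x [y [z [/in_M1plusE[hx tx] hy [l [hl /vequivE hz]] ->]]]].
exists (vscale c x), (vscale c y), (vscale c z); split.
- by apply/in_M1plusE; split; [exact: in_M1Z | rewrite coef_scale linearZ /= tx].
- exact: in_VLplus1Z.
- exists [seq (c * t.1.1, t.1.2, t.2) | t <- l]; split.
    by move=> t /mapP[t' /hl h ->].
  apply/vequivE; rewrite coef_scale hz -map_comp !coef_flatten scaler_sumr.
  by apply: eq_bigr => t _; rewrite !coef_scale scalerA.
by rewrite !coef_scale !scalerDr.
Qed.

Lemma in_M1_nil : in_M1 [::].
Proof. by move=> b _; rewrite /coef big_nil. Qed.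

Lemma in_M1plus_nil : in_M1plus [::].
Proof. by apply/in_M1plusE; split; [exact: in_M1_nil | rewrite coef_nil linear0]. Qed.

Lemma in_M1minus_nil : in_M1minus [::].
Proof.
by apply/in_M1minusE; split; [exact: in_M1_nil | rewrite coef_nil linear0 oppr0].
Qed.

Lemma in_VLplus1_nil : in_VLplus1 [::].
Proof. by exists [::], [::]; split; [exact: in_M1plus_nil | split; [exact: in_M1minus_nil|]]. Qed.

Lemma in_C2_nil k : in_C2_VLplus k [::].
Proof. by exists [::]. Qed.

Lemma good_M1 k x : in_M1plus x -> good k (coef x).
Proof.
move=> h; exists x, [::], [::]; rewrite !coef_nil !addr0; split=> //.
  exact: in_VLplus1_nil.
exact: in_C2_nil.
Qed.

Lemma good_VLplus1 k y : in_VLplus1 y -> good k (coef y).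
Proof.
move=> h; exists [::], y, [::]; rewrite !coef_nil !addr0 add0r; split=> //.
  exact: in_M1plus_nil.
exact: in_C2_nil.
Qed.

Lemma good_C2 k z : in_C2_VLplus k z -> good k (coef z).
Proof.
move=> h; exists [::], [::], z; rewrite !coef_nil !add0r; split=> //.
  exact: in_M1plus_nil.
exact: in_VLplus1_nil.
Qed.

Lemma good0 k : good k 0.
Proof. rewrite -coef_nil; apply: good_M1; exact: in_M1plus_nil. Qed.

Lemma good_sum k (I : eqType) (s : seq I) (F : I -> fV) :
  (forall i, i \in s -> good k (F i)) -> good k (\sum_(i <- s) F i).
Proof.
by move=> h; rewrite big_seq; apply: big_ind => //; [exact: good0 | exact: goodD].
Qed.

Definition E1 : vec := [:: (1, ([::], 1)); (1, ([::], -1))].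

Lemma good_E1 k (n : int) w : n <= -2 -> in_VLplus w -> good k (coef (vmode k E1 n w)).
Proof.
(* With r = -2 - n, lowering the mode -2 by r translations gives n. *)
move=> hn hw; pose r := `|(-2 - n)%R|%N.
have [|c c0 h] := @umode_iter_Dlin k r (-2) _; first by [].
pose e (j : int) : vec := bvec ([::], j).
pose u := iter r Dlin (e 1) ++ iter r Dlin (e (-1)).
(* Theta swaps the two halves of u, which places u in V_L^+. *)
have te j : lin theta (iter r Dlin (e j)) = iter r Dlin (e (- j)).
  elim: (r) => [|r' IH]; first by rewrite /e /bvec lin_thetaE /= expr0 mulr1.
  by rewrite !iterS theta_Dlin IH.
have hu : in_VLplus u.
  apply/in_VLplusE; rewrite coef_cat linearD /= -!coef_theta !te opprK.
  exact: addrC.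
have um w' : umode k u (-2) w' = c *: umode k E1 n w'.
  have uD x y s : umode k (x ++ y) s w' = umode k x s w' + umode k y s w'.
    by rewrite /umode big_cat.
  have -> : E1 = e 1 ++ e (-1) by [].
  by rewrite /u !uD !h scalerDr; congr (_ *: umode _ _ _ _ + _ *: umode _ _ _ _); lia.
pose z := vscale c^-1 (vmode k u (-2) w).
have -> : coef (vmode k E1 n w) = coef z.
  rewrite /z coef_scale !coef_vmode scaler_sumr; apply: eq_bigr => t _.
  by rewrite um [RHS]scale_swap [c^-1 *: _]scalerA mulVf ?scale1r.
apply: good_C2; exists [:: (c^-1, u, w)]; split; first by move=> t; rewrite inE => /eqP ->.
by move=> b; rewrite /= cats0.
Qed.

(** Twice the projection onto V_L^+. *)
Definition sym (f : fV) : fV := f + Theta f.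

Lemma sym_is_linear : linear sym.
Proof.
by move=> c f g; rewrite /sym linearP scalerDr addrACA.
Qed.
HB.instance Definition _ := GRing.isLinear.Build C fV fV _ sym sym_is_linear.

Lemma sym_Theta f : sym (Theta f) = sym f.
Proof. by rewrite /sym ThetaK addrC. Qed.

Lemma sqr_sign n : (-1) ^+ n * (-1) ^+ n = 1 :> C.
Proof. by rewrite -exprMn mulrNN mulr1 expr1n. Qed.

Lemma sym_opp p m : sym (delta (p, - m)) = (-1) ^+ size p *: sym (delta (p, m)).
Proof.
rewrite -[in RHS]sym_Theta Theta_delta [in RHS]linearZ /= scalerA sqr_sign scale1r //.
Qed.

(* Stated for an arbitrary subspace Q so that the induction on p can replace Q
   by its preimage under alpha(-i-1); [Aneg_evmode] shows that preimage
   contains the generators again. *)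
Lemma delta_generated k (m : int) (Q : fV -> Prop) : (0 < k)%N -> 2 <= m ->
  (forall c f g, Q f -> Q g -> Q (c *: f + g)) ->
  (forall (n : int) q, n <= -2 -> Q (coef (evmode k 1 n (q, m - 1)))) ->
  forall p, Q (delta (p, m)).
Proof.
move=> k0 m2 Qlin Qev p; elim: p Q Qlin Qev => [|i p IH] Q Qlin Qev.
  have := Qev (- ((2 * k)%:Z * (m - 1)) - 1) [::].
  rewrite (@coef_evmode _ _ _ _ _ 1) /fdeg ?big_nil // /evop big_ord1.
  rewrite [X in Eneg _ _ X](_ : _ = 0) ?mulr1; last first.
    by move: (_ * _) => x /=; lia.
  by rewrite subrK; apply; nia.
have -> : delta (i :: p, m) = Aop k (Negz i) (delta (p, m)).
  by rewrite -coef_amode [coef (amode _ _ _)]coef_delta big_seq1 scale1r.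
apply: (IH (fun f => Q (Aop k (Negz i) f))) => [c f g hf hg|n q hn].
  by rewrite linearP; apply: Qlin.
rewrite Aneg_evmode addrC; apply: Qlin; apply: Qev => //; lia.
Qed.

(* The list v may contain monomials of another charge whose coefficients cancel. *)
Lemma charge_part v d m : homog d m (coef v) ->
  (coef v : fV) = \sum_(t <- [seq t <- v | t.2.2 == m]) t.1 *: delta t.2.
Proof.
move=> h; rewrite -coef_delta; apply: fV_ext => b.
rewrite [in RHS]/coef big_filter_cond.
case: (eqVneq b.2 m) => [e|ne].
  by rewrite /coef; apply: eq_bigl => t; rewrite e; case: (_ == m); rewrite ?andbF.
rewrite big1 => [|t /and3P[/eqP e1 _ /eqP e2]]; last by rewrite -e1 e2 eqxx in ne.
by apply/eqP; apply: contraNT ne => /h[_ ->].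
Qed.

Lemma good_sym_nat k (m : nat) p : (0 < k)%N -> good k (sym (delta (p, m%:Z))).
Proof.
move=> k0; elim/ltn_ind: m p => -[|[|m]] IH p.
- pose x := bvec (p, 0) ++ lin theta (bvec (p, 0)).
  have -> : sym (delta (p, 0)) = coef x by rewrite coef_cat coef_theta.
  apply: good_M1; apply/in_M1plusE; split.
    move=> b hb; rewrite coef_cat coef_theta -/(delta _) Theta_delta fVDE fVZE oppr0.
    by rewrite deltaE /= eq_sym (negbTE hb) andbF mulr0 addr0.
  by rewrite coef_cat coef_theta linearD /= ThetaK addrC.
- have M1 : in_M1 (bvec (p, 0)).
    by move=> b hb; rewrite -/(delta _) deltaE /= eq_sym (negbTE hb) andbF.
  have tE (n : int) : coef (tensor_e (bvec (p, 0)) n) = delta (p, n).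
    by rewrite /tensor_e /= add0r.
  have t0 : Theta (delta (p, 0)) = (-1) ^+ size p *: delta (p, 0).
    by rewrite Theta_delta oppr0.
  (* The parity of the length of p decides between M(1)^- with e^alpha - e^(-alpha) and M(1)^+ with
     e^alpha + e^(-alpha). *)
  case: (boolP (odd (size p))) => sp.
    pose y := tensor_e (bvec (p, 0)) 1 ++ vscale (-1) (tensor_e (bvec (p, 0)) (-1)).
    have -> : sym (delta (p, 1)) = coef y.
      rewrite /sym coef_cat coef_scale !tE Theta_delta -signr_odd sp expr1 //.
    apply: good_VLplus1; exists [::], (bvec (p, 0)); split; first exact: in_M1plus_nil.
    split; last by [].
    by apply/in_M1minusE; split; rewrite // t0 -signr_odd sp expr1 scaleN1r.
  pose y := tensor_e (bvec (p, 0)) 1 ++ tensor_e (bvec (p, 0)) (-1).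
  have -> : sym (delta (p, 1)) = coef y.
    rewrite /sym coef_cat !tE Theta_delta -signr_odd (negbTE sp) expr0 scale1r //.
  apply: good_VLplus1; exists (bvec (p, 0)), [::]; split; last first.
    by split; [exact: in_M1minus_nil | rewrite /= ?cats0].
  by apply/in_M1plusE; split; rewrite // t0 -signr_odd (negbTE sp) expr0 scale1r.
(* The subspace Q is the preimage under [sym] of the good vectors. *)
apply: (@delta_generated k m.+2%:Z (fun f => good k (sym f))) => //.
  by move=> c f g hf hg; rewrite linearP; apply: goodD => //; apply: goodZ.
move=> n q hn; pose m1 : int := m.+2%:Z - 1.
pose f : fV := coef (evmode k 1 n (q, m1)); rewrite -/m1 -/f.
pose g : fV := coef (evmode k (-1) n (q, m1)).
pose w := bvec (q, m1) ++ lin theta (bvec (q, m1)).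
have hw : in_VLplus w.
  by apply/in_VLplusE; rewrite coef_cat coef_theta linearD /= ThetaK addrC.
(* Expanding E_n w gives f and g from the first half of w and, by [Theta_evmode], their theta-images
   from the second. *)
have -> : sym f = coef (vmode k E1 n w) + (-1) *: sym g.
  rewrite coef_vmode big_cat lin_thetaE /= !big_seq1 /= /umode !big_cons !big_nil /=.
  rewrite /sym /f /g !Theta_evmode !opprK.
  apply: fV_ext => b; rewrite !(fVDE, fVZE); ring.
apply: goodD; first exact: good_E1.
(* The vector g has charge m1 - 1 = m, two below the current charge, so the induction hypothesis
   covers each of its monomials. *)
apply: goodZ; rewrite /g (charge_part (@homog_evmode k (-1) n q m1)).
rewrite linear_sum; apply: good_sum => -[c [p' m']]; rewrite mem_filter => /andP[/eqP /= -> _].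
rewrite linearZ; apply: goodZ; have -> : m1 + -1 = m%:Z by rewrite /m1; lia.
by apply: IH; lia.
Qed.

Lemma good_sym k b : (0 < k)%N -> good k (sym (delta b)).
Proof.
case: b => p [m|m] k0; first exact: good_sym_nat.
by rewrite NegzE sym_opp; apply: goodZ; apply: good_sym_nat.
Qed.

Theorem theorem4p8 (k : nat) (hk : (3 <= k)%N) (w : vec) :
  in_VLplus w ->
  exists x y z : vec,
    [/\ in_M1plus x, in_VLplus1 y, in_C2_VLplus k z & vequiv w (x ++ y ++ z)].
Proof.
move/in_VLplusE => hw; have k0 : (0 < k)%N by apply: leq_trans hk.
have : good k (coef w).
  (* Theta fixes w, so w is half of its symmetrization, and linearity leaves only basis vectors. *)
  have -> : (coef w : fV) = 2%:R^-1 *: sym (coef w).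
    rewrite /sym hw -mulr2n -[X in _ *: X]scaler_nat scalerA.
    by rewrite mulVf ?scale1r // C_natr_neq0.
  apply: goodZ; rewrite coef_delta linear_sum; apply: good_sum => t _.
  by rewrite linearZ; apply: goodZ; apply: good_sym.
move=> [x [y [z [hx hy hz e]]]]; exists x, y, z; split=> //.
by apply/vequivE; rewrite !coef_cat e addrA.
Qed.
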